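(* Every $k$-degenerate graph $G$ of maximum degree $\Delta$ satisfies $$\chi_s'(G) \le (4k-1)\Delta - k(2k+1) + 1.$$
   Context: Here $k$ is a non-negative integer, and graphs are finite, simple and undirected. A graph $G$ is $k$-degenerate if every (nonempty) subgraph of $G$ contains a vertex of degree at most $k$ in that subgraph. A strong edge coloring of $G$ is a coloring of the edges of $G$ in which every color class is an induced matching of $G$, that is, any two distinct edges of the same color share no vertex, and no vertex of one is adjacent in $G$ to a vertex of the other. The strong chromatic index $\chi_s'(G)$ is the minimum number of colors in a strong edge coloring of $G$.
   Formalization: The hypothesis k ≤ Δ is added; without it the claim is false (K2 is 2-degenerate with Δ = 1, where the bound is −2 but the strong chromatic index is 1), and it holds automatically when k is the degeneracy of G. *)

(* Defs.v *)
From HB Require Import structures.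
From mathcomp Require Import all_boot all_order all_algebra.

Set Implicit Arguments.
Unset Strict Implicit.
Unset Printing Implicit Defensive.

Record sgraph := SGraph {
  vertex :> finType;
  adj : rel vertex;
  adj_sym : symmetric adj;
  adj_irrefl : irreflexive adj }.

Definition degree (V : finType) (f : rel V) (v : V) : nat :=
  #|[set u | f v u]|.

Definition max_degree (G : sgraph) : nat := \max_(v : G) degree (@adj G) v.

(* (S, f) is a subgraph of G with vertex set S and adjacency f;              *)
(* it need not be induced.                                                    *)
Definition is_subgraph (G : sgraph) (S : {set G}) (f : rel G) : Prop :=
  [/\ symmetric f, subrel f (@adj G) & forall x y, f x y -> x \in S].

Definition degenerate (k : nat) (G : sgraph) : Prop :=
  forall (S : {set G}) (f : rel G), is_subgraph S f -> S != set0 ->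
  exists2 v, v \in S & degree f v <= k.

Definition edges (G : sgraph) : {set {set G}} :=
  [set A : {set G} | [exists x, exists y, adj x y && (A == [set x; y])]].

Definition edge (G : sgraph) := {A : {set G} | A \in edges G}.

Definition induced_matching (G : sgraph) (M : {set {set G}}) : bool :=
  (M \subset edges G) &&
  [forall A in M, forall B in M, (A != B) ==>
     [disjoint A & B] && [forall x in A, forall y in B, ~~ adj x y]].

Definition color_class (G : sgraph) (n : nat) (c : {ffun edge G -> 'I_n})
    (i : 'I_n) : {set {set G}} :=
  [set val A | A : edge G & c A == i].

Definition strong_edge_coloring (G : sgraph) (n : nat)
    (c : {ffun edge G -> 'I_n}) : bool :=
  [forall i, induced_matching (color_class c i)].

(* Colors are assigned to edges only, so an edgeless graph is colorable with  *)
(* n = 0.                                                                     *)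
Definition strong_edge_colorable (G : sgraph) (n : nat) : bool :=
  [exists c : {ffun edge G -> 'I_n}, strong_edge_coloring c].

Lemma strong_edge_colorable_exists (G : sgraph) :
  exists n, strong_edge_colorable G n.
Proof.
exists #|{: edge G}|; apply/existsP; exists [ffun A => enum_rank A].
apply/forallP=> i; apply/andP; split.
  by apply/subsetP=> _ /imsetP[A _ ->]; exact: valP.
apply/forall_inP=> _ /imsetP[A + ->]; rewrite inE ffunE => /eqP Ai.
apply/forall_inP=> _ /imsetP[B + ->]; rewrite inE ffunE => /eqP Bi.
by rewrite (enum_rank_inj (etrans Ai (esym Bi))) eqxx.
Qed.

Definition strong_chromatic_index (G : sgraph) : nat :=
  ex_minn (strong_edge_colorable_exists G).

(* Main.v *)
Require Import Defs.
From HB Require Import structures.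
From mathcomp Require Import all_boot all_order all_algebra.
From mathcomp Require Import zify.

Set Implicit Arguments.
Unset Strict Implicit.
Unset Printing Implicit Defensive.

(** A k-degenerate graph can be dismantled by repeatedly deleting a vertex of
    degree at most k; ranking the vertices by deletion time, every vertex has
    at most k neighbours of larger rank ([elimination_ranking]).  Color the
    edges greedily ([greedy_coloring]), in decreasing order of the larger of
    the ranks of their ends.  Let uv be an edge to be colored, with v of
    smaller rank than u.  An edge f that comes no later in this order and
    conflicts with uv has an end w, other than u and v, that is adjacent to u
    or to v ([conflict_neighbour]).

    - If w is one of the a <= k upper neighbours of u, or one of the b <= k
      upper neighbours of v (u being one of these), then f is one of the at
      most Delta edges at w.
    - If w is a lower neighbour of u or of v, then w ranks below u, whereas
      some end of f ranks no lower than u; hence f is one of the at most k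
      edges that join w to a higher vertex.

    Since v is itself a lower neighbour of u, this leaves at most
      a Delta + (Delta - a - 1) k + (b - 1) Delta + (Delta - b) k
    edges.  As k <= Delta, the expression increases with a and b; its value at
    a = b = k is (4k - 1) Delta - k (2k + 1), so one more color is enough.
    This count is [card_conflict]. *)

(** * Greedy coloring *)

(** Set a sparse element aside, color the others, and put it back: its fewer
    than n conflicts leave a color free.  The partial colorings met on the way
    are total functions into nat, whose values off the colored set are junk. *)
Lemma greedy_coloring (T : finType) (c : rel T) (n : nat) :
    symmetric c ->
    (forall S : {set T}, S != set0 ->
       exists2 x, x \in S & #|[set y in S | (y != x) && c x y]| < n) ->
  exists f : {ffun T -> 'I_n}, forall x y, x != y -> c x y -> f x != f y.
Proof.
move=> c_sym sparse.
have [f f_lt f_ok] : exists2 f : T -> nat, forall x, x \in setT -> f x < n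
    & {in setT &, forall x y, x != y -> c x y -> f x != f y}.
  move: [set: T] => S; have [m] := ubnP #|S|; elim: m S => // m IHm S.
  have [-> _|S_neq0] := eqVneq S set0.
    by exists (fun=> 0) => [x|x y]; rewrite inE.
  have [x xS x_sparse] := sparse _ S_neq0.
  rewrite (cardsD1 x) xS ltnS => /IHm[f f_lt f_ok].
  (* Fewer than n colors occur among the conflicting elements. *)
  have [i i_free] : exists i : 'I_n,
      forall y, y \in S -> y != x -> c x y -> f y != i.
    set K := [set y in S | (y != x) && c x y] in x_sparse.
    set used := [set i : 'I_n | [exists y in K, f y == i]].
    have used_lt : #|used| < #|'I_n|.
      rewrite card_ord; apply: leq_ltn_trans x_sparse.
      rewrite !cardE -(size_map val) -(size_map f (enum K)).
      apply: uniq_leq_size; first by rewrite (map_inj_uniq val_inj) enum_uniq.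
      move=> _ /mapP[i + ->]; rewrite mem_enum inE => /exists_inP[y yK /eqP fy].
      by apply/mapP; exists y; rewrite ?mem_enum // fy.
    have /subsetPn[i _ i_free] : ~~ ([set: 'I_n] \subset used).
      by apply/negP => /subset_leq_card; rewrite cardsT leqNgt used_lt.
    exists i => y yS yx xy; apply: contra i_free => fy.
    by rewrite inE; apply/exists_inP; exists y; rewrite // inE yS yx.
  exists (fun y => if y == x then val i else f y) => [y yS|y z yS zS yz cyz].
    by case: (eqVneq y x) => [_|yx]; [apply: ltn_ord | rewrite f_lt // !inE yx].
  case: (eqVneq y x) => [yx|yx]; case: (eqVneq z x) => [zx|zx].
  - by rewrite yx zx eqxx in yz.
  - by rewrite eq_sym i_free // -yx.
  - by rewrite i_free // c_sym -zx.
  - by apply: f_ok; rewrite ?inE ?yx ?zx.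
exists [ffun x => Ordinal (f_lt x (in_setT x))] => x y xy cxy.
by rewrite !ffunE -val_eqE f_ok ?in_setT.
Qed.

Lemma card_bigcup_leq (I T : finType) (P : {set I}) (F : I -> {set T}) m :
  {in P, forall i, #|F i| <= m} -> #|\bigcup_(i in P) F i| <= #|P| * m.
Proof.
move=> F_le; rewrite -sum_nat_const.
apply: leq_trans (leq_sum _ (fun i iP => F_le i iP)).
elim/big_rec2: _ => [|i s A _ le_As]; first by rewrite cards0.
by rewrite (leq_trans (leq_card_setU _ _)) // leq_add2l.
Qed.

(** * Neighbourhoods in a ranked graph *)

Definition upper (G : sgraph) (r : G -> nat) (x : G) : {set G} :=
  [set y | adj x y & r x < r y].

Definition lower (G : sgraph) (r : G -> nat) (x : G) : {set G} :=
  [set y | adj x y & r y < r x].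

(** Deleted vertices get smaller ranks than the remaining ones, so the upper
    neighbours of a vertex are those present when it is deleted. *)
Lemma elimination_ranking (k : nat) (G : sgraph) : degenerate k G ->
  exists2 r : G -> nat, injective r & forall x, #|upper r x| <= k.
Proof.
move=> degG.
have [r r_inj r_up] : exists2 r : G -> nat, {in setT &, injective r}
    & {in setT, forall x, #|upper r x :&: setT| <= k}.
  move: [set: G] => S; have [m] := ubnP #|S|; elim: m S => // m IHm S.
  have [-> _|S_neq0] := eqVneq S set0.
    by exists (fun=> 0) => [x|x]; rewrite inE.
  pose f := [rel x y | [&& adj x y, x \in S & y \in S] : bool] : rel G.
  have f_sub : is_subgraph S f.
    split=> [x y|x y /and3P[]|x y /and3P[]] //=.
    by rewrite /f /= adj_sym [(x \in S) && _]andbC.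
  have [v vS deg_v] := degG _ _ f_sub S_neq0.
  rewrite (cardsD1 v) vS ltnS => /IHm[r r_inj r_up].
  exists (fun x => if x == v then 0 else (r x).+1) => [x y xS yS|x xS].
    case: (eqVneq x v) => [->|xv]; case: (eqVneq y v) => [->|yv] //= [].
    by apply: r_inj; rewrite !inE ?xv ?yv.
  case: (eqVneq x v) => [->|xv].
    apply: leq_trans deg_v; apply/subset_leq_card/subsetP=> y.
    by rewrite !inE => /andP[/andP[vy _] yS]; rewrite /f /= vy vS yS.
  apply: leq_trans (r_up x _); last by rewrite !inE xv.
  apply/subset_leq_card/subsetP=> y; rewrite !inE (negPf xv).
  by case: (eqVneq y v); rewrite ?andbF // ltnS.
exists r => [x y|x]; first exact: r_inj.
by rewrite -[upper r x]setIT r_up.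
Qed.

Section RankedGraph.

Variables (G : sgraph) (r : G -> nat) (k Delta : nat).
Hypothesis r_inj : injective r.
Hypothesis r_up : forall x, #|upper r x| <= k.
Hypothesis deg_le : forall x, degree (@adj G) x <= Delta.

Lemma adj_rank_neq (x y : G) : adj x y -> r x != r y.
Proof. by rewrite (inj_eq r_inj); apply: contraTneq => ->; rewrite adj_irrefl. Qed.

Lemma mem_upper_or_lower (x y : G) :
  adj x y -> (y \in upper r x) || (y \in lower r x).
Proof. by move=> xy; rewrite !inE xy -neq_ltn adj_rank_neq. Qed.

Lemma card_upper_lower (x : G) : #|upper r x| + #|lower r x| <= Delta.
Proof.
apply: leq_trans (deg_le x); rewrite -cardsUI.
have -> : upper r x :&: lower r x = set0.
  apply/setP=> y; rewrite !inE; apply/negP => /andP[/andP[_ xy] /andP[_ yx]].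
  by rewrite ltnNge (ltnW xy) in yx.
rewrite cards0 addn0; apply/subset_leq_card/subsetP=> y.
by rewrite !inE => /orP[] /andP[].
Qed.

(** * Conflicting edges *)

Definition conflict (A B : {set G}) : bool :=
  ~~ ([disjoint A & B] && [forall x in A, forall y in B, ~~ adj x y]).

Lemma conflict_sym : symmetric conflict.
Proof.
suff imp A B : conflict A B -> conflict B A by move=> A B; apply/idP/idP; apply: imp.
apply: contra => /andP[dBA /forall_inP nBA]; rewrite disjoint_sym dBA /=.
apply/forall_inP=> x xA; apply/forall_inP=> y yB.
by rewrite adj_sym (forall_inP (nBA y yB)).
Qed.

Lemma edgesP (A : {set G}) :
  reflect (exists x y, adj x y /\ A = [set x; y]) (A \in edges G).
Proof.
rewrite inE; apply: (iffP existsP) => [[x /existsP[y /andP[xy /eqP->]]]|].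
  by exists x, y.
by case=> x [y [xy ->]]; exists x; apply/existsP; exists y; rewrite xy eqxx.
Qed.

Lemma edge_at (A : {set G}) (x : G) :
  A \in edges G -> x \in A -> exists2 y, adj x y & A = [set x; y].
Proof.
case/edgesP=> a [b [ab ->]] /set2P[] ->; first by exists b.
by exists a; rewrite 1?adj_sym // setUC.
Qed.

(** An end of f adjacent to an end of uv can itself be u or v; the other end of
    f is then adjacent to it, and differs from u and v because f is not uv. *)
Lemma conflict_neighbour (u v : G) (A : {set G}) :
    adj u v -> A \in edges G -> A != [set u; v] -> conflict [set u; v] A ->
  exists2 w, w \in A & adj u w && (w != v) || adj v w && (w != u).
Proof.
move=> uv EA Auv.
have at_end x : x \in A -> x \in [set u; v] ->
    exists2 w, w \in A & adj u w && (w != v) || adj v w && (w != u).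
  move=> xA /set2P xuv; have [w xw defA] := edge_at EA xA.
  exists w; first by rewrite defA set22.
  case: xuv xw defA => -> xw defA; rewrite xw /=.
    by apply/orP; left; apply: contraNneq Auv => <-; rewrite defA.
  by apply/orP; right; apply: contraNneq Auv => <-; rewrite defA setUC.
rewrite /conflict negb_and => /orP[].
  by rewrite -setI_eq0 => /set0Pn[x /setIP[xuv xA]]; apply: (at_end x).
case/forall_inPn => x xuv /forall_inPn[w wA]; rewrite negbK => xw.
have [|wuv] := boolP (w \in [set u; v]); first exact: at_end.
exists w => //; move: wuv; rewrite !inE negb_or => /andP[-> ->].
by case/set2P: xuv xw => -> ->; rewrite ?orbT.
Qed.

Definition star (x : G) (N : {set G}) : {set {set G}} :=
  [set [set x; y] | y in N].

Lemma card_star (x : G) (N : {set G}) : #|star x N| <= #|N|.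
Proof. exact: leq_imset_card. Qed.

(** The order in which the greedy coloring proceeds, from large to small. *)
Definition height (A : {set G}) : nat := \max_(x in A) r x.

Lemma height_edge (x y : G) : height [set x; y] = maxn (r x) (r y).
Proof.
have [->|xy] := eqVneq x y; first by rewrite setUid /height big_set1 maxnn.
by rewrite /height big_setU1 ?inE // big_set1.
Qed.

Lemma mem_star_upper (A : {set G}) (w : G) :
  A \in edges G -> w \in A -> r w < height A -> A \in star w (upper r w).
Proof.
move=> EA wA; have [y wy ->] := edge_at EA wA; rewrite height_edge => w_lt.
by apply/imset_f; rewrite inE wy /=; rewrite leq_max ltnn in w_lt.
Qed.

Lemma mem_star_neighbours (A : {set G}) (w : G) :
  A \in edges G -> w \in A -> A \in star w [set y | adj w y].
Proof.
by move=> EA wA; have [y wy ->] := edge_at EA wA; apply/imset_f; rewrite inE.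
Qed.

(** Edges of the same height are counted as well, so that ties in the greedy
    order are harmless.  The part of the bound that is subtracted from
    4 k Delta stands on the left, to avoid truncated subtraction. *)
Lemma card_conflict (u v : G) : adj u v -> r v < r u -> k <= Delta ->
  #|[set A in edges G | [&& A != [set u; v], conflict [set u; v] A
                          & height [set u; v] <= height A]]|
    + (Delta + 2 * k * k + k) <= 4 * k * Delta.
Proof.
move=> uv vu k_le; rewrite height_edge (maxn_idPl (ltnW vu)); set K := [set _ in _ | _].
pose full w := star w [set y | adj w y]; pose up w := star w (upper r w).
have sub_K : K \subset
    (\bigcup_(w in upper r u) full w :|: \bigcup_(w in lower r u :\ v) up w)
    :|: (\bigcup_(w in upper r v :\ u) full w :|: \bigcup_(w in lower r v) up w).
  apply/subsetP=> A; rewrite inE => /and4P[EA Auv cA hA].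
  have [w wA] := conflict_neighbour uv EA Auv cA.
  have up_w : r w < r u -> A \in up w.
    by move=> wu; apply: mem_star_upper => //; apply: leq_trans wu hA.
  have full_w := mem_star_neighbours EA wA.
  case/orP=> /andP[xw w_neq]; case/orP: (mem_upper_or_lower xw) => w_in;
    rewrite !in_setU; apply/orP; [left|left|right|right]; apply/orP.
  - by left; apply/bigcupP; exists w.
  - right; apply/bigcupP; exists w; first by rewrite in_setD1 w_neq.
    by apply: up_w; move: w_in; rewrite inE => /andP[].
  - by left; apply/bigcupP; exists w; rewrite // in_setD1 w_neq.
  - right; apply/bigcupP; exists w => //; apply: up_w.
    by move: w_in; rewrite inE => /andP[_ wv]; apply: ltn_trans vu.
have full_le w : #|full w| <= Delta := leq_trans (card_star _ _) (deg_le w).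
have up_le w : #|up w| <= k := leq_trans (card_star _ _) (r_up w).
have K_le := leq_trans (subset_leq_card sub_K) (leq_card_setU _ _).
have := leq_trans K_le (leq_add (leq_card_setU _ _) (leq_card_setU _ _)).
move: (card_bigcup_leq (P := upper r u) (fun w _ => full_le w))
  (card_bigcup_leq (P := lower r u :\ v) (fun w _ => up_le w))
  (card_bigcup_leq (P := upper r v :\ u) (fun w _ => full_le w))
  (card_bigcup_leq (P := lower r v) (fun w _ => up_le w)).
have v_in : v \in lower r u by rewrite inE uv.
have u_in : u \in upper r v by rewrite inE adj_sym uv.
have := card_upper_lower u; have := card_upper_lower v.
have := r_up u; have := r_up v.
rewrite (cardsD1 v (lower r u)) v_in (cardsD1 u (upper r v)) u_in.
move: #|_ :\ v| #|_ :\ u| #|upper r u| #|lower r v| => c b a d.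
move=> b_le a_le bd ac K1 K2 K3 K4 KK.
suff : a * Delta + c * k + (b * Delta + d * k)
    + (Delta + 2 * k * k + k) <= 4 * k * Delta by lia.
(* The bound is increasing in a and b because e = Delta - k is nonnegative. *)
have [e Delta_eq] : exists e, Delta = k + e by exists (Delta - k); lia.
have ae : a * e <= k * e by rewrite leq_mul2r a_le orbT.
have be : (1 + b) * e <= k * e by rewrite leq_mul2r b_le orbT.
have cak : (1 + c + a) * k <= (k + e) * k by rewrite leq_mul2r; lia.
have bdk : (1 + b + d) * k <= (k + e) * k by rewrite leq_mul2r; lia.
by rewrite Delta_eq; lia.
Qed.

(** * The bound on the strong chromatic index *)

(** In any set of edges, one of least height is in conflict with fewer than n
    others of the set. *)
Lemma strong_edge_colorable_ranked (n : nat) : k <= Delta ->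
  4 * k * Delta < n + (Delta + 2 * k * k + k) -> strong_edge_colorable G n.
Proof.
move=> k_le n_gt.
have [|S S_neq0|f f_ok] := @greedy_coloring (edge G)
  (fun A B => conflict (val A) (val B)) n.
- by move=> A B; rewrite conflict_sym.
- have [A0 A0S] := set0Pn _ S_neq0.
  case: (arg_minnP (fun A => height (val A)) A0S) => A AS A_min.
  exists A => //.
  have [u [v [uv vu defA]]] : exists u v, [/\ adj u v, r v < r u & val A = [set u; v]].
    have [x [y [xy ->]]] := edgesP _ (valP A).
    have := adj_rank_neq xy; rewrite neq_ltn => /orP[] lt.
      by exists y, x; rewrite adj_sym setUC.
    by exists x, y.
  have := card_conflict uv vu k_le; set K := [set _ in _ | _] => K_le.
  rewrite -(ltn_add2r (Delta + 2 * k * k + k)); apply: leq_ltn_trans n_gt.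
  apply: leq_trans K_le; rewrite leq_add2r -(card_imset _ val_inj).
  apply/subset_leq_card/subsetP=> _ /imsetP[B + ->].
  rewrite inE => /and3P[BS BA cAB].
  by rewrite in_set (valP B) -defA (inj_eq val_inj) BA cAB A_min.
apply/existsP; exists f; apply/forallP=> i; apply/andP; split.
  by apply/subsetP=> _ /imsetP[A _ ->]; exact: valP.
apply/forall_inP=> _ /imsetP[A + ->]; rewrite inE => /eqP Ai.
apply/forall_inP=> _ /imsetP[B + ->]; rewrite inE => /eqP Bi.
apply/implyP; rewrite (inj_eq val_inj) => AB; apply/negPn/negP => cAB.
by have := f_ok _ _ AB cAB; rewrite Ai Bi eqxx.
Qed.

End RankedGraph.

Theorem theorem2 (k Delta : nat) (G : sgraph)
  (degG : degenerate k G) (maxG : max_degree G = Delta)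
  (le_k_Delta : (k <= Delta)%N) :
  ((strong_chromatic_index G)%:Z <=
     (4%:Z * k%:Z - 1) * Delta%:Z - k%:Z * (2%:Z * k%:Z + 1) + 1)%R.
Proof.
have [r r_inj r_up] := elimination_ranking degG.
have deg_le x : degree (@adj G) x <= Delta by rewrite -maxG leq_bigmax.
(* An edge needs an upper neighbour, so for k = 0 the graph is edgeless. *)
have Delta0 : k = 0 -> Delta = 0.
  move=> k0; rewrite -maxG; apply/eqP; rewrite -leqn0; apply/bigmax_leqP=> x _.
  rewrite leqn0 cards_eq0; apply/eqP/setP=> y; rewrite !inE.
  apply/negP => xy; have := adj_rank_neq r_inj xy; rewrite neq_ltn.
  have up0 z w : adj z w -> (r z < r w) = false.
    move=> zw; apply/negP => lt; have := r_up z.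
    by rewrite k0 leqn0 cards_eq0 => /eqP/setP/(_ w); rewrite !inE zw lt.
  by rewrite !up0 // adj_sym.
pose n := (4 * k * Delta).+1 - (Delta + 2 * k * k + k).
have n_big : Delta + 2 * k * k + k <= (4 * k * Delta).+1.
  by case: (posnP k) => [k0|k_gt0]; [rewrite k0 Delta0 | nia].
have colG : strong_edge_colorable G n.
  by apply: (strong_edge_colorable_ranked r_inj r_up deg_le) => //; lia.
have : strong_chromatic_index G <= n.
  by rewrite /strong_chromatic_index; case: ex_minnP => m _; apply.
by rewrite /n; nia.
Qed.
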